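(* Let $U\colon \mathbf{CompHaus}^{\mathrm{op}}\to\mathbf{Set}$ be a faithful functor. Then the canonical comparison map $$\kappa_U\colon \operatorname{colim}_{n\in\mathbb N} U([0,1]^n)\longrightarrow U\bigl([0,1]^{\mathbb N_{>0}}\bigr)$$ induced by the functions $U(\pi_n^{\mathrm{op}})\colon U([0,1]^n)\to U([0,1]^{\mathbb N_{>0}})$ is not surjective. In fact, $$\operatorname{im}\bigl(U(\delta^{\mathrm{op}})\bigr)\nsubseteq\operatorname{im}(\kappa_U),$$ where $\delta\colon[0,1]^{\mathbb N_{>0}}\to[0,1]$ is the continuous map $\delta(x)=\sum_{k=1}^{\infty}2^{-k}x_k$.
   Context: $\mathbf{CompHaus}$ is the category of compact Hausdorff spaces and continuous maps, $\mathbf{CompHaus}^{\mathrm{op}}$ is its opposite category, and for a continuous map $f\colon X\to Y$ one writes $f^{\mathrm{op}}\colon Y\to X$ for the corresponding arrow of $\mathbf{CompHaus}^{\mathrm{op}}$. $\mathbf{Set}$ is the category of sets and functions. $\mathbb N$ includes $0$, and $\mathbb N_{>0}=\mathbb N\setminus\{0\}$. Finite tuples are indexed by $\{1,\dots,n\}$ and infinite sequences by $\mathbb N_{>0}$; $[0,1]^n$ and $[0,1]^{\mathbb N_{>0}}$ carry the product topology. For each $n\in\mathbb N$, let $p_n\colon[0,1]^{n+1}\to[0,1]^n$, $(x_1,\dots,x_n,x_{n+1})\mapsto(x_1,\dots,x_n)$, and $\pi_n\colon[0,1]^{\mathbb N_{>0}}\to[0,1]^n$, $(x_1,x_2,\dots)\mapsto(x_1,\dots,x_n)$.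 In $\mathbf{CompHaus}^{\mathrm{op}}$, the sequence $$[0,1]^0\xrightarrow{p_0^{\mathrm{op}}}[0,1]^1\xrightarrow{p_1^{\mathrm{op}}}[0,1]^2\xrightarrow{p_2^{\mathrm{op}}}[0,1]^3\xrightarrow{p_3^{\mathrm{op}}}\cdots$$ has colimit $[0,1]^{\mathbb N_{>0}}$ with structure maps $\pi_n^{\mathrm{op}}\colon[0,1]^n\to[0,1]^{\mathbb N_{>0}}$. The colimit $\operatorname{colim}_{n\in\mathbb N}U([0,1]^n)$ is the colimit in $\mathbf{Set}$ of the image under $U$ of this sequence. *)

(* Defs.v *)
From HB Require Import structures.
From Stdlib Require Import Relation_Operators.
From mathcomp Require Import all_boot all_order all_algebra.
From mathcomp Require Import all_classical all_reals all_analysis.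
From mathcomp Require Import lra.

Set Implicit Arguments.
Unset Strict Implicit.
Unset Printing Implicit Defensive.

Import Order.TTheory GRing.Theory Num.Theory.
Import numFieldNormedType.Exports.

Local Open Scope classical_set_scope.
Local Open Scope ring_scope.

(** * Categories and functors *)

Record category := Category {
  obj :> Type;
  mor : obj -> obj -> Type;
  idm : forall a : obj, mor a a;
  hcomp : forall a b c : obj, mor b c -> mor a b -> mor a c;
  hcomp_idl : forall (a b : obj) (f : mor a b), hcomp (idm b) f = f;
  hcomp_idr : forall (a b : obj) (f : mor a b), hcomp f (idm a) = f;
  hcompA : forall (a b c d : obj) (h : mor c d) (g : mor b c) (f : mor a b),
    hcomp h (hcomp g f) = hcomp (hcomp h g) f }.
Arguments mor {_} _ _.
Arguments idm {_} _.
Arguments hcomp {_ _ _ _} _ _.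

Definition opposite (C : category) : category :=
  @Category C (fun a b => @mor C b a) (fun a => idm a)
    (fun a b c g f => hcomp f g)
    (fun a b f => hcomp_idr f) (fun a b f => hcomp_idl f)
    (fun a b c d h g f => esym (hcompA f g h)).

Definition opm (C : category) (a b : C) (f : mor a b) :
  @mor (opposite C) b a := f.

Record functor (C D : category) := Functor {
  fobj :> C -> D;
  fmor : forall a b : C, mor a b -> mor (fobj a) (fobj b);
  fmor_id : forall a : C, fmor (idm a) = idm (fobj a);
  fmor_comp : forall (a b c : C) (g : mor b c) (f : mor a b),
    fmor (hcomp g f) = hcomp (fmor g) (fmor f) }.
Arguments fmor {_ _} _ {_ _} _.

Definition faithful (C D : category) (F : functor C D) : Prop :=
  forall (a b : C) (f g : mor a b), fmor F f = fmor F g -> f = g.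

(** * Sequences, cocones and colimits *)

Record seq_diagram (C : category) := SeqDiagram {
  seq_obj :> nat -> C;
  seq_map : forall n : nat, mor (seq_obj n) (seq_obj n.+1) }.
Arguments seq_map {_} _ _.

Record cocone (C : category) (S : seq_diagram C) := Cocone {
  apex :> C;
  leg : forall n : nat, mor (S n) apex;
  leg_comm : forall n : nat, hcomp (leg n.+1) (seq_map S n) = leg n }.
Arguments leg {_ _} _ _.

Definition is_colimit (C : category) (S : seq_diagram C) (K : cocone S) : Prop :=
  forall L : cocone S, exists! u : mor K L, forall n, hcomp u (leg K n) = leg L n.

Definition map_diagram (C D : category) (F : functor C D) (S : seq_diagram C) :
  seq_diagram D := SeqDiagram (fun n => fmor F (seq_map S n)).

Lemma map_cocone_comm (C D : category) (F : functor C D) (S : seq_diagram C)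
  (K : cocone S) (n : nat) :
  hcomp (fmor F (leg K n.+1)) (seq_map (map_diagram F S) n) = fmor F (leg K n).
Proof. by rewrite /= -fmor_comp leg_comm. Qed.

Definition map_cocone (C D : category) (F : functor C D) (S : seq_diagram C)
  (K : cocone S) : cocone (map_diagram F S) :=
  Cocone (map_cocone_comm F K).

(** * Sets *)

Definition Sets : category :=
  @Category Type (fun A B => A -> B) (fun A => fun x => x)
    (fun A B C g f => fun x => g (f x))
    (fun A B f => erefl) (fun A B f => erefl)
    (fun A B C D h g f => erefl).

Section SetColimit.
Variable S : seq_diagram Sets.

(* Disjoint union of the sets S n, modulo the equivalence relation generated by
   identifying each element with its image at the next stage; the points of the
   quotient are the equivalence classes. *)
Definition colim_step (x y : {n : nat & S n}) : Prop :=
  y = existT _ (projT1 x).+1 (seq_map S (projT1 x) (projT2 x)).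

Definition colim_class (x : {n : nat & S n}) : {n : nat & S n} -> Prop :=
  clos_refl_sym_trans _ colim_step x.

Definition set_colim : Type :=
  {P : {n : nat & S n} -> Prop | exists x, P = colim_class x}.

Definition colim_in (n : nat) (a : S n) : set_colim :=
  exist _ (colim_class (existT _ n a)) (ex_intro _ _ erefl).

Lemma colim_class_eq (x y : {n : nat & S n}) :
  colim_class x y -> colim_class x = colim_class y.
Proof.
move=> xy; apply/funext => z; apply/propext; split => h.
  exact: rst_trans (rst_sym _ _ _ _ xy) h.
exact: rst_trans xy h.
Qed.

Lemma colim_in_comm (n : nat) :
  @hcomp Sets _ _ _ (@colim_in n.+1) (seq_map S n) = @colim_in n.
Proof.
apply/funext => a /=; apply: eq_exist => /=.
by apply: colim_class_eq; apply: rst_sym; apply: rst_step.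
Qed.

Definition set_colim_cocone : cocone S :=
  @Cocone Sets S set_colim colim_in colim_in_comm.

Definition colim_desc (L : cocone S) : set_colim -> apex L :=
  fun c => let x := projT1 (cid (proj2_sig c)) in leg L (projT1 x) (projT2 x).

Lemma colim_descE (L : cocone S) (n : nat) (a : S n) :
  colim_desc L (colim_in a) = leg L n a.
Proof.
rewrite /colim_desc; case: cid => x /= ex.
have : colim_class x (existT _ n a) by rewrite -ex; apply: rst_refl.
rewrite /colim_class => h {ex}.
suff H y : clos_refl_sym_trans _ colim_step x y ->
  leg L (projT1 x) (projT2 x) = leg L (projT1 y) (projT2 y) by exact: (H _ h).
elim=> {x y h} [x y ->|//|x y _ -> //|x y z _ -> _ -> //] /=.
exact: (esym (congr1 (fun f => f _) (leg_comm L (projT1 x)))).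
Qed.

Lemma colim_in_surj (c : set_colim) : exists n (a : S n), c = colim_in a.
Proof.
case: c => P [[n a] e]; exists n, a; exact: eq_exist.
Qed.

Lemma set_colim_cocone_colimit : is_colimit set_colim_cocone.
Proof.
move=> L; exists (colim_desc L); split=> [n|u hu].
  by apply/funext => a; exact: colim_descE.
apply/funext => c; have [n [a ->]] := colim_in_surj c.
by rewrite colim_descE -hu.
Qed.

End SetColimit.

(* For U : C -> Sets and a cocone K under S, the comparison map
   colim_n U (S n) -> U K induced by the functions U (leg K n). *)
Definition comparison_map (C : category) (U : functor C Sets) (S : seq_diagram C)
    (K : cocone S) : set_colim (map_diagram U S) -> U (apex K) :=
  colim_desc (map_cocone U K).
Arguments comparison_map {_} _ {_} _ _.

(** * Compact Hausdorff spaces *)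

Record compHaus := MkCompHaus {
  space :> topologicalType;
  compHaus_compact : compact [set: space];
  compHaus_hausdorff : hausdorff_space space }.

Program Definition CompHaus : category :=
  @Category compHaus (fun X Y => continuousType X Y)
    (fun X => (@idfun X : continuousType X X))
    (fun X Y Z g f => (g \o f : continuousType X Z)) _ _ _.
Next Obligation. by move=> X Y f; apply/continuousEP. Qed.
Next Obligation. by move=> X Y f; apply/continuousEP. Qed.
Next Obligation. by move=> X Y Z W h g f; apply/continuousEP. Qed.

Section Cubes.
Variable R : realType.

Definition unitI : topologicalType := set_type `[0%R : R, 1%R]%classic.

Definition uval (t : unitI) : R := set_val t.

Lemma uval_continuous : continuous uval.
Proof. exact: initial_continuous. Qed.

Lemma uval_ge0 (t : unitI) : 0 <= uval t.
Proof. by have := set_valP t; rewrite /= in_itv /= => /andP[]. Qed.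

Lemma uval_le1 (t : unitI) : uval t <= 1.
Proof. by have := set_valP t; rewrite /= in_itv /= => /andP[]. Qed.

Lemma unitI_compact : compact [set: unitI].
Proof.
move=> F PF _.
have [|p [p01 clp]] := @segment_compact R 0 1 (uval @ F) _.
  by apply: (@filterS _ F _ [set: unitI]) => [t _|]; [exact: set_valP|exact: filterT].
exists (exist _ p (mem_set p01)); split=> // A B FA [_ [[W oW <-] Wp] sWB].
have [||r [[t At <-] Wt]] := clp (uval @` A) W.
- by apply: (@filterS _ F _ A) FA => t At; exists t.
- exact: open_nbhs_nbhs.
- by exists t; split=> //; exact: sWB.
Qed.

Lemma unitI_hausdorff : hausdorff_space unitI.
Proof.
move=> p q pq; apply: val_inj; apply: (@Rhausdorff R) => A B pA qB.
have [t [At Bt]] := pq _ _ (uval_continuous pA) (uval_continuous qB).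
by exists (uval t).
Qed.

Section Power.
Variable I : eqType.

Definition power : topologicalType := prod_topology (fun _ : I => unitI).

Lemma power_compact : compact [set: power].
Proof.
have := @tychonoff I (fun=> unitI) (fun=> setT) (fun=> unitI_compact).
by congr compact; apply/seteqP; split.
Qed.

Lemma power_hausdorff : hausdorff_space power.
Proof. exact: (@hausdorff_product I (fun=> unitI) (fun=> unitI_hausdorff)). Qed.

Lemma coord_continuous (i : I) : continuous (fun x : power => x i).
Proof. exact: (@proj_continuous I (fun=> unitI) i). Qed.

Lemma power_continuous (T : topologicalType) (f : T -> power) :
  (forall i, continuous (fun t => f t i)) -> continuous f.
Proof.
move=> cf x; apply/cvg_sup => i.
exact: (@continuous_comp_initial power T unitI (fun y => y i) f (cf i)).
Qed.

End Power.

Definition unit_interval : CompHaus := MkCompHaus unitI_compact unitI_hausdorff.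

(* [0,1]^n; the coordinate x_i (1 <= i <= n) is x applied to the ordinal i - 1. *)
Definition cube (n : nat) : CompHaus :=
  MkCompHaus (@power_compact 'I_n) (@power_hausdorff 'I_n).

(* [0,1]^{N_{>0}}; the coordinate x_k (k >= 1) is x (k - 1). *)
Definition hilbert_cube : CompHaus :=
  MkCompHaus (@power_compact nat) (@power_hausdorff nat).

Definition cube_proj_fun (n : nat) (x : cube n.+1) : cube n :=
  fun i : 'I_n => x (widen_ord (leqnSn n) i).

Lemma cube_proj_continuous (n : nat) : continuous (@cube_proj_fun n).
Proof. apply: power_continuous => i; exact: coord_continuous. Qed.

Definition cube_proj (n : nat) : @mor CompHaus (cube n.+1) (cube n) :=
  mkcts (@cube_proj_continuous n).

Definition hilbert_proj_fun (n : nat) (x : hilbert_cube) : cube n :=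
  fun i : 'I_n => x (val i).

Lemma hilbert_proj_continuous (n : nat) : continuous (@hilbert_proj_fun n).
Proof. apply: power_continuous => i; exact: coord_continuous. Qed.

Definition hilbert_proj (n : nat) : @mor CompHaus hilbert_cube (cube n) :=
  mkcts (@hilbert_proj_continuous n).

Definition cube_sequence : seq_diagram (opposite CompHaus) :=
  @SeqDiagram (opposite CompHaus) cube (fun n => opm (cube_proj n)).

Lemma hilbert_cocone_comm (n : nat) :
  hcomp (opm (hilbert_proj n.+1)) (seq_map cube_sequence n) =
  opm (hilbert_proj n).
Proof. by apply/continuousEP. Qed.

Definition hilbert_cocone : cocone cube_sequence :=
  @Cocone (opposite CompHaus) cube_sequence hilbert_cube
    (fun n => opm (hilbert_proj n)) hilbert_cocone_comm.

Lemma hilbert_cocone_colimit : is_colimit hilbert_cocone.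
Proof.
move=> L.
have legE n (y : apex L) (m : nat) (i : 'I_n) : leg L (n + m)%N y
    (widen_ord (leq_addr m n) i) = leg L n y i.
  elim: m => [|m IH].
    move: (leq_addr 0 n); rewrite addn0 => h.
    by congr (leg L n y); apply: val_inj.
  rewrite -IH -[in RHS](leg_comm L (n + m)%N) /=.
  move: (leq_addr m.+1 n); rewrite addnS => h.
  by congr (leg L (n + m).+1 y); apply: val_inj.
pose u (y : apex L) : hilbert_cube := fun k => leg L k.+1 y ord_max.
have cu : continuous u.
  apply: power_continuous => k y.
  apply: (continuous_comp (f := leg L k.+1) (g := fun x : cube k.+1 => x ord_max)).
    exact: cts_fun.
  exact: coord_continuous.
exists (mkcts cu : @mor CompHaus (apex L) hilbert_cube); split=> [n|v hv].
  apply/continuousEP => y; apply/funext => i; rewrite -[LHS]/(leg L i.+1 y ord_max).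
  rewrite -(legE i.+1 y (n - i.+1)%N ord_max).
  have e : (i.+1 + (n - i.+1) = n)%N by rewrite subnKC.
  move: (leq_addr _ _); rewrite e => h.
  by congr (leg L n y); apply: val_inj.
apply/continuousEP => y; apply/funext => k.
by rewrite /= /mkcts /u -hv.
Qed.

Definition delta_series (x : hilbert_cube) : R^nat :=
  series (fun k => 2 ^- k.+1 * uval (x k)).

Definition delta_val (x : hilbert_cube) : R := limn (delta_series x).

Lemma delta_seriesS (x : hilbert_cube) (n : nat) :
  delta_series x n.+1 = delta_series x n + 2 ^- n.+1 * uval (x n).
Proof. by rewrite /delta_series /series /= big_nat_recr. Qed.

Lemma delta_series_nd (x : hilbert_cube) : nondecreasing_seq (delta_series x).
Proof.
apply/nondecreasing_seqP => n; rewrite delta_seriesS lerDl.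
by rewrite mulr_ge0 ?uval_ge0 // invr_ge0 exprn_ge0.
Qed.

Lemma delta_series_upper (x : hilbert_cube) :
  nonincreasing_seq (fun n => delta_series x n + 2 ^- n).
Proof.
apply/nonincreasing_seqP => n; rewrite delta_seriesS -addrA lerD2l.
have h0 : 0 <= 2 ^- n.+1 :> R by rewrite invr_ge0 exprn_ge0.
have -> : 2 ^- n = 2 ^- n.+1 + 2 ^- n.+1 :> R.
  by rewrite exprSr invfM; exact: splitr.
by rewrite lerD2r ler_piMr // uval_le1.
Qed.

Lemma delta_series_tail (x : hilbert_cube) (n m : nat) : (n <= m)%N ->
  delta_series x m <= delta_series x n + 2 ^- n.
Proof.
move=> nm; apply: le_trans (delta_series_upper x nm).
by rewrite lerDl invr_ge0 exprn_ge0.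
Qed.

Lemma delta_series_cvg (x : hilbert_cube) : cvgn (delta_series x).
Proof.
apply: nondecreasing_is_cvgn; first exact: delta_series_nd.
exists (delta_series x 0%N + 2 ^- 0%N) => _ [m _ <-].
exact: delta_series_tail.
Qed.

Lemma delta_val_lower (x : hilbert_cube) (n : nat) :
  delta_series x n <= delta_val x.
Proof. exact: nondecreasing_cvgn_le (@delta_series_nd x) (@delta_series_cvg x) n. Qed.

Lemma delta_val_upper (x : hilbert_cube) (n : nat) :
  delta_val x <= delta_series x n + 2 ^- n.
Proof.
apply: limr_le; first exact: delta_series_cvg.
by exists n => // m /= nm; exact: delta_series_tail.
Qed.

Lemma delta_val_itv (x : hilbert_cube) : delta_val x \in `[0%R, 1%R]%classic.
Proof.
apply/mem_set => /=; rewrite in_itv /=; apply/andP; split.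
  by apply: le_trans (delta_val_lower x 0); rewrite /delta_series /series /= big_geq.
apply: le_trans (delta_val_upper x 0) _.
by rewrite /delta_series /series /= big_geq // add0r expr0 invr1.
Qed.

Lemma approx_continuous (T : topologicalType) (S : nat -> T -> R) (d : T -> R) :
  (forall n, continuous (S n)) ->
  (forall n x, S n x <= d x <= S n x + 2 ^- n) -> continuous d.
Proof.
move=> cS hS x; apply/cvgrPdist_lt => e e0.
have [n hn] : exists n, 2 ^- n < e / 2 :> R.
  have := @cvg_geometric R 1 2^-1.
  rewrite ger0_norm ?invr_ge0 // invf_lt1 // ltr1n => /(_ isT).
  move=> /cvgrPdist_lt /(_ (e / 2)); rewrite divr_gt0 // => /(_ isT) [n _ /(_ n)].
  move=> /(_ (leqnn n)); rewrite sub0r normrN /= mul1r exprVn ger0_norm.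
    by exists n.
  by rewrite invr_ge0 exprn_ge0.
have := cS n x; move/cvgrPdist_lt => /(_ (e / 2)); rewrite divr_gt0 // => /(_ isT).
apply: filterS => y; rewrite !ltr_norml => /andP[h1 h2].
have [/andP[a1 a2] /andP[b1 b2]] := (hS n x, hS n y).
by apply/andP; split; lra.
Qed.

Lemma delta_val_continuous : continuous delta_val.
Proof.
have cS n : continuous (delta_series ^~ n).
  elim: n => [|n IH] x.
    rewrite (_ : delta_series ^~ 0%N = cst 0); last first.
      by apply/funext => y; rewrite /delta_series /series /= big_geq.
    exact: cst_continuous.
  rewrite (_ : delta_series ^~ n.+1 =
    (fun y => delta_series y n + 2 ^- n.+1 * uval (y n))); last first.
    by apply/funext => y; rewrite delta_seriesS.
  apply: (@continuousD R R^o (hilbert_cube : topologicalType)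
    (delta_series ^~ n)); first exact: IH.
  apply: continuousM; first exact: cst_continuous.
  apply: (continuous_comp (f := fun y : hilbert_cube => y n)).
    exact: coord_continuous.
  exact: uval_continuous.
apply: (approx_continuous cS) => n x.
by rewrite delta_val_lower delta_val_upper.
Qed.

Definition delta_fun (x : hilbert_cube) : unit_interval :=
  exist (fun t : R => t \in `[0%R, 1%R]%classic) (delta_val x) (delta_val_itv x).

Lemma delta_continuous : continuous delta_fun.
Proof. apply: continuous_comp_initial; exact: delta_val_continuous. Qed.

Definition delta : @mor CompHaus hilbert_cube unit_interval :=
  mkcts delta_continuous.

End Cubes.

(* Main.v *)
Require Import Defs.
From mathcomp Require Import all_boot all_order all_algebra.
From mathcomp Require Import all_classical all_reals all_analysis.
From mathcomp Require Import ring.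

(** Write Q for the Hilbert cube, and 0, 1 for the two endpoints of [0,1].
Suppose that every value of [U delta^op] lies in the image of the comparison
map, and fix [a : U [0,1]]. Then [U(delta^op) a = U(pi_n^op) b] for some [n]
and [b]. For a point [x] of Q, seen as a map from the one-point space [0,1]^0
into Q, functoriality gives [U((delta x)^op) a = U((pi_n x)^op) b], which depends
only on the first [n] coordinates of [x] ([point_value_prefix]).

On the other hand [delta] reads off a binary expansion, and the two expansions
w0111... and w1000... of a number let carries propagate: a function [phi] on
[0,1] such that [phi (delta x)] ignores all but finitely many digits of [x] must
take the same value at 0 and at 1 ([finite_prefix_endpoints]). With
[phi t = U(t^op) a], this says that the points 0 and 1 of [0,1] induce functions
[U [0,1] -> U [0,1]^0] that agree at [a].

The number [n] varies with [a], but this conclusion does not mention it, so it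
holds for all [a] at once: [U] identifies the distinct points 0 and 1 of [0,1],
and is not faithful. *)

Set Implicit Arguments.
Unset Strict Implicit.
Unset Printing Implicit Defensive.

Import Order.TTheory GRing.Theory Num.Theory.
Import numFieldNormedType.Exports.

Local Open Scope classical_set_scope.

Section BinaryExpansions.
Variable R : realType.
Local Open Scope ring_scope.

Lemma digit_itv (b : bool) : (b%:R : R) \in `[0%R, 1%R]%classic.
Proof. by apply/mem_set; rewrite /= in_itv /= ler0n lern1 leq_b1. Qed.

Definition digit (b : bool) : unitI R :=
  exist (fun t : R => t \in `[0%R, 1%R]%classic) b%:R (digit_itv b).

Definition with_tail (n : nat) (x : hilbert_cube R) (b : bool) :
  hilbert_cube R := fun k => if (k < n)%N then x k else digit b.

Lemma delta_series_prefix (x y : hilbert_cube R) (n : nat) :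
  (forall k, (k < n)%N -> x k = y k) -> delta_series x n = delta_series y n.
Proof.
move=> xy; rewrite /delta_series /series /= !big_mkord.
by apply: eq_bigr => i _; rewrite xy.
Qed.

(** The digits after the [n]-th contribute [b] times the sum of the [2^-k] for
[k > n], which is [2^-n]. *)
Lemma delta_val_with_tail (n : nat) (x : hilbert_cube R) (b : bool) :
  delta_val (with_tail n x b) = delta_series x n + b%:R * 2 ^- n.
Proof.
set y := with_tail n x b; set l := RHS.
(* The invariant: replacing the remaining tail by its value leaves the sum
   unchanged at every stage. *)
have partial m : delta_series y (m + n) = l - b%:R * 2 ^- (m + n).
  elim: m => [|m IH].
    rewrite add0n /l addrK; apply: delta_series_prefix => k kn.
    by rewrite /y /with_tail kn.
  rewrite addSn delta_seriesS IH {IH}.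
  have -> : uval (y (m + n)%N) = b%:R.
    by rewrite /y /with_tail ltnNge leq_addl.
  have -> : 2 ^- (m + n) = 2 * 2 ^- (m + n).+1 :> R.
    by rewrite exprS invfM mulrA divff ?mul1r // pnatr_eq0.
  ring.
apply/cvg_lim => //; rewrite -(cvg_shiftn n).
rewrite (_ : (fun m => _) = (fun m => l - b%:R * 2 ^- (m + n))); last first.
  by apply/funext.
rewrite (cvg_shiftn n (fun m => l - b%:R * 2 ^- m : R) (nbhs l)).
have {2}-> : l = l - b%:R * 0 by rewrite mulr0 subr0.
apply: cvgB; first exact: cvg_cst.
apply: cvgM; first exact: cvg_cst.
rewrite (_ : (fun m => 2 ^- m) = geometric 1 2^-1); last first.
  by apply/funext => m /=; rewrite mul1r exprVn.
by apply: cvg_geometric; rewrite ger0_norm ?invr_ge0 // invf_lt1 // ltr1n.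
Qed.

Lemma delta_fun_with_tail (n m : nat) (x y : hilbert_cube R) (b c : bool) :
  delta_series x n + b%:R * 2 ^- n = delta_series y m + c%:R * 2 ^- m ->
  delta_fun (with_tail n x b) = delta_fun (with_tail m y c).
Proof. by move=> e; apply: val_inj; rewrite /= !delta_val_with_tail. Qed.

(** Carry propagation. If the tail after place [k+1] can be changed, then so can
the tail after place [k], by the chain w000... , w0111... = w1000... , w111...
in which only the middle step, an equality of numbers, changes place [k+1]. *)
Lemma carry (T : Type) (phi : unitI R -> T) (k : nat) :
  (forall w, phi (delta_fun (with_tail k.+1 w false)) =
             phi (delta_fun (with_tail k.+1 w true))) ->
  forall w, phi (delta_fun (with_tail k w false)) =
            phi (delta_fun (with_tail k w true)).
Proof.
move=> swap w.
have prefix b : delta_series (with_tail k w b) k = delta_series w k.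
  by apply: delta_series_prefix => i ik; rewrite /with_tail ik.
have next b : uval (with_tail k w b k) = b%:R by rewrite /with_tail ltnn.
have half : 2 ^- k = 2 * 2 ^- k.+1 :> R.
  by rewrite exprS invfM mulrA divff ?mul1r // pnatr_eq0.
have -> : delta_fun (with_tail k w false) =
          delta_fun (with_tail k.+1 (with_tail k w false) false).
  by apply: delta_fun_with_tail; rewrite delta_seriesS prefix next /=; ring.
rewrite swap.
have -> : delta_fun (with_tail k.+1 (with_tail k w false) true) =
          delta_fun (with_tail k.+1 (with_tail k w true) false).
  by apply: delta_fun_with_tail; rewrite !delta_seriesS !prefix !next /=; ring.
rewrite swap; congr phi.
by apply: delta_fun_with_tail; rewrite delta_seriesS prefix next half /=; ring.
Qed.

Lemma finite_prefix_endpoints (T : Type) (phi : unitI R -> T) (n : nat) :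
  (forall x y : hilbert_cube R, (forall k, (k < n)%N -> x k = y k) ->
     phi (delta_fun x) = phi (delta_fun y)) ->
  phi (digit false) = phi (digit true).
Proof.
move=> phi_prefix.
have endpoint (w : hilbert_cube R) b : digit b = delta_fun (with_tail 0 w b).
  apply: val_inj; rewrite /= delta_val_with_tail.
  by rewrite /delta_series /series /= big_geq // add0r expr0 invr1 mulr1.
pose w : hilbert_cube R := fun=> digit false.
rewrite !(endpoint w); move: w.
have : forall w, phi (delta_fun (with_tail n w false)) =
                 phi (delta_fun (with_tail n w true)).
  by move=> w; apply: phi_prefix => k kn; rewrite /with_tail kn.
by elim: n {phi_prefix} => [//|n IH] /carry.
Qed.

End BinaryExpansions.

Section Points.
Variable R : realType.

(** The cube [0,1]^0 serves as the one-point space. *)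
Definition point (X : CompHaus) (x : X) : @mor CompHaus (cube R 0) X :=
  mkcts (@cst_continuous (cube R 0) X x).

Lemma comp_point (X Y : CompHaus) (f : @mor CompHaus X Y) (x : X) :
  hcomp f (point x) = point (f x).
Proof. by apply/continuousEP. Qed.

Lemma point_inj (X : CompHaus) : injective (@point X).
Proof.
move=> x y /(congr1 (fun f : @mor CompHaus (cube R 0) X =>
  f (fun=> digit R false))); exact.
Qed.

Variable U : functor (opposite CompHaus) Sets.

Lemma point_value (X Y : CompHaus) (f : @mor CompHaus X Y) (x : X) (a : U Y) :
  fmor U (opm (point x)) (fmor U (opm f) a) = fmor U (opm (point (f x))) a.
Proof.
rewrite -comp_point.
exact: (esym (congr1 (fun g => g a) (fmor_comp U (opm (point x)) (opm f)))).
Qed.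

(** If [U f^op] sends [a] into the [n]-th stage of the colimit, evaluating [a] at
[f x] amounts to evaluating an element of [U [0,1]^n] at the projection of [x]. *)
Lemma point_value_prefix (X : CompHaus) (f : @mor CompHaus (hilbert_cube R) X)
    (a : U X) (n : nat) (b : U (cube R n)) (x y : hilbert_cube R) :
  fmor U (opm f) a = fmor U (opm (hilbert_proj R n)) b ->
  (forall k, (k < n)%N -> x k = y k) ->
  fmor U (opm (point (f x))) a = fmor U (opm (point (f y))) a.
Proof.
move=> fab xy; rewrite -!point_value fab !point_value.
congr (fmor U (opm (point _)) b).
by apply: (@funext 'I_n (unitI R)) => i; exact: (xy i (ltn_ord i)).
Qed.

Lemma range_comparison_map (u : U (hilbert_cube R)) :
  range (comparison_map U (hilbert_cocone R)) u ->
  exists n (b : U (cube R n)), u = fmor U (opm (hilbert_proj R n)) b.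
Proof.
move=> [c _ <-]; have [n [b ->]] := colim_in_surj c.
by exists n, b; rewrite /comparison_map colim_descE.
Qed.

End Points.

Theorem theorem3p1 (R : realType) (U : functor (opposite CompHaus) Sets)
    (U_faithful : faithful U) :
  let kappa := comparison_map U (hilbert_cocone R) in
  ~ set_surj [set: set_colim (map_diagram U (cube_sequence R))]
             [set: U (hilbert_cube R)] kappa
  /\ ~ (range (fmor U (opm (delta R))) `<=` range kappa).
Proof.
move=> kappa.
have delta_range : ~ (range (fmor U (opm (delta R))) `<=` range kappa).
  move=> sub.
  suff /U_faithful/(@point_inj R)/(congr1 (@uval R))/eqP :
      fmor U (opm (point R (digit R false : unit_interval R))) =
      fmor U (opm (point R (digit R true : unit_interval R))).
    by rewrite /= eq_sym oner_eq0.
  apply/funext => a.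
  have [n [b ab]] := range_comparison_map (sub _ (imageT _ a)).
  pose phi (t : unit_interval R) := fmor U (opm (point R t)) a.
  apply: (@finite_prefix_endpoints R _ phi n) => x y xy.
  exact: point_value_prefix ab xy.
split=> // surj; apply: delta_range => u _; exact: surj.
Qed.
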